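(* Let $G$ be a countable linear sofic group. Then there exist a non-principal ultrafilter $\omega$ on $\mathbb{N}$, a sequence $n_k\to\infty$, a sequence $(F_k)_k$ of finite fields and an injective group morphism $\Phi:G\to\prod_{k\to\omega}GL_{n_k}(F_k)/d_\omega$. In particular, $G$ is weakly sofic.
   Context: For a field $F$ and $a,b\in M_n(F)$, $d_{rk}(a,b)=\operatorname{rk}(a-b)/n$, a bi-invariant metric on $GL_n(F)$. For fields $F_k$, $\prod_{k\to\omega}GL_{n_k}(F_k)/d_\omega$ is the quotient of $\prod_k GL_{n_k}(F_k)$ by the normal subgroup $\{(a_k)_k:\lim_{k\to\omega}d_{rk}(a_k,\mathrm{Id})=0\}$. A countable group is linear sofic if it admits an injective group morphism into $\prod_{k\to\omega}GL_{n_k}(\mathbb{C})/d_\omega$ for some non-principal ultrafilter $\omega$ and $n_k\to\infty$. A group is weakly sofic if it embeds into a metric ultraproduct $\prod_{k\to\omega}(G_k,d_k)$ of finite groups $G_k$, each equipped with a bi-invariant metric $d_k$ (the quotient of $\prod_k G_k$ by $\{(g_k)_k:\lim_{k\to\omega}d_k(g_k,e)=0\}$). *)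

(* Defs.v *)
From Stdlib Require Import Reals Lra Classical ClassicalEpsilon
  FunctionalExtensionality.
From HB Require Import structures.
From mathcomp Require Import all_boot all_order all_algebra all_fingroup
  all_field.

Set Implicit Arguments.
Unset Strict Implicit.
Unset Printing Implicit Defensive.

Definition Cx : Type := (R * R)%type.

Local Open Scope R_scope.
Definition Cx0 : Cx := (0, 0).
Definition Cx1 : Cx := (1, 0).
Definition Cxadd (x y : Cx) : Cx := (fst x + fst y, snd x + snd y).
Definition Cxopp (x : Cx) : Cx := (- fst x, - snd x).
Definition Cxmul (x y : Cx) : Cx :=
  (fst x * fst y - snd x * snd y, fst x * snd y + snd x * fst y).
Definition Cxinv (x : Cx) : Cx :=
  let d := fst x * fst x + snd x * snd x in (fst x / d, - snd x / d).

Lemma Cx_eq_dec : forall x y : Cx, {x = y} + {x <> y}.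
Proof.
intros [a b] [c d].
destruct (Req_EM_T a c) as [->|h]; [|right; congruence].
destruct (Req_EM_T b d) as [->|h]; [left; reflexivity|right; congruence].
Qed.

Definition Cx_eqb (x y : Cx) : bool := if Cx_eq_dec x y then true else false.
Lemma Cx_eqP : Equality.axiom Cx_eqb.
Proof. intros x y; unfold Cx_eqb; destruct (Cx_eq_dec x y); constructor; auto. Qed.

Lemma Cxaddr_A : associative Cxadd.
Proof. intros [a b] [c d] [e f]; unfold Cxadd; simpl; f_equal; ring. Qed.
Lemma Cxaddr_C : commutative Cxadd.
Proof. intros [a b] [c d]; unfold Cxadd; simpl; f_equal; ring. Qed.
Lemma Cxadd0 : left_id Cx0 Cxadd.
Proof. intros [a b]; unfold Cxadd; simpl; f_equal; ring. Qed.
Lemma CxaddN : left_inverse Cx0 Cxopp Cxadd.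
Proof. intros [a b]; unfold Cxadd, Cx0; simpl; f_equal; ring. Qed.
Lemma Cxmul_A : associative Cxmul.
Proof. intros [a b] [c d] [e f]; unfold Cxmul; simpl; f_equal; ring. Qed.
Lemma Cxmul_C : commutative Cxmul.
Proof. intros [a b] [c d]; unfold Cxmul; simpl; f_equal; ring. Qed.
Lemma Cxmul1 : left_id Cx1 Cxmul.
Proof. intros [a b]; unfold Cxmul, Cx1; simpl; f_equal; ring. Qed.
Lemma CxmulDl : left_distributive Cxmul Cxadd.
Proof. intros [a b] [c d] [e f]; unfold Cxmul, Cxadd; simpl; f_equal; ring. Qed.
Lemma Cx1_neq0 : ~~ Cx_eqb Cx1 Cx0.
Proof.
unfold Cx_eqb; destruct (Cx_eq_dec Cx1 Cx0) as [h|h]; auto.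
exfalso; injection h; apply R1_neq_R0.
Qed.
Lemma CxmulV : forall x, ~~ Cx_eqb x Cx0 -> Cxmul (Cxinv x) x = Cx1.
Proof.
intros [a b]; unfold Cx_eqb; destruct (Cx_eq_dec (a, b) Cx0) as [e0|hn];
  [discriminate|intros _].
assert (hd : a * a + b * b <> 0).
{ intro e; apply hn; unfold Cx0.
  assert (a = 0) by nra. assert (b = 0) by nra. subst; reflexivity. }
unfold Cxmul, Cxinv, Cx1; simpl; f_equal; field; exact hd.
Qed.
Lemma Cxinv0 : Cxinv Cx0 = Cx0.
Proof. unfold Cxinv, Cx0; simpl; f_equal; unfold Rdiv; ring. Qed.

Definition Cx_find (P : pred Cx) (n : nat) : option Cx :=
  match excluded_middle_informative (exists x, P x) with
  | left h => Some (proj1_sig (constructive_indefinite_description _ h))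
  | right _ => None
  end.
Lemma Cx_find_correct P n x : Cx_find P n = Some x -> P x.
Proof.
unfold Cx_find; destruct excluded_middle_informative as [h|h]; [|discriminate].
intro e; injection e; intro hx; rewrite <- hx; exact (proj2_sig (constructive_indefinite_description (fun x : Cx => P x) h)).
Qed.
Lemma Cx_find_complete (P : pred Cx) : (exists x, P x) -> exists n, Cx_find P n.
Proof.
intro h; exists 0%nat; unfold Cx_find;
  destruct excluded_middle_informative; [reflexivity|contradiction].
Qed.
Lemma Cx_find_ext (P Q : pred Cx) : P =1 Q -> Cx_find P =1 Cx_find Q.
Proof.
intros h n; assert (P = Q) by (apply functional_extensionality; exact h).
subst; reflexivity.
Qed.
Close Scope R_scope.

Definition complex : Type := Cx.
HB.instance Definition _ := hasDecEq.Build complex Cx_eqP.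
HB.instance Definition _ :=
  hasChoice.Build complex Cx_find_correct Cx_find_complete Cx_find_ext.
HB.instance Definition _ :=
  GRing.isZmodule.Build complex Cxaddr_A Cxaddr_C Cxadd0 CxaddN.
HB.instance Definition _ :=
  GRing.Zmodule_isComNzRing.Build complex Cxmul_A Cxmul_C Cxmul1 CxmulDl Cx1_neq0.
HB.instance Definition _ := GRing.ComNzRing_isField.Build complex CxmulV Cxinv0.


Definition nat_ultrafilter (w : (nat -> Prop) -> Prop) : Prop :=
  [/\ w (fun _ => True),
      ~ w (fun _ => False),
      (forall A B : nat -> Prop, w A -> (forall k, A k -> B k) -> w B),
      (forall A B : nat -> Prop, w A -> w B -> w (fun k => A k /\ B k)) &
      (forall A : nat -> Prop, w A \/ w (fun k => ~ A k))].

Definition non_principal (w : (nat -> Prop) -> Prop) : Prop :=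
  forall m : nat, ~ w (fun k => k = m).

Definition omega_lim0 (w : (nat -> Prop) -> Prop) (x : nat -> R) : Prop :=
  forall eps : R, Rlt R0 eps -> w (fun k => Rlt (Rabs (x k)) eps).

Definition tends_to_infty (n : nat -> nat) : Prop :=
  forall N : nat, exists K : nat, forall k : nat, (K <= k)%N -> (N <= n k)%N.

Definition group_axioms (G : Type) (mul : G -> G -> G) (inv : G -> G) (one : G)
  : Prop :=
  [/\ (forall x y z, mul x (mul y z) = mul (mul x y) z),
      (forall x, mul one x = x) &
      (forall x, mul (inv x) x = one)].

Definition countable_type (G : Type) : Prop :=
  exists f : G -> nat, injective f.

Definition d_rk (F : fieldType) (n : nat) (a b : 'M[F]_n) : R :=
  Rdiv (INR (\rank (a - b)%R)) (INR n).

(* phi : G -> prod_k GL_{n_k}(F_k) (a choice of representatives) induces an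
   injective group morphism G -> prod_{k -> w} GL_{n_k}(F_k) / d_w, where the
   quotient is by N = {(a_k) | lim_{k->w} d_rk(a_k, Id) = 0}:
   - each phi g k is invertible (phi g lies in the product of the GL's);
   - phi(gh) (phi(g) phi(h))^-1 lies in N  (morphism to the quotient);
   - phi(g)^-1 phi(h) in N (equality of cosets) implies g = h (injectivity). *)
Definition GL_ultraproduct_embedding (G : Type) (mul : G -> G -> G)
  (w : (nat -> Prop) -> Prop) (F : nat -> fieldType) (n : nat -> nat)
  (phi : G -> forall k : nat, 'M[F k]_(n k)) : Prop :=
  [/\ (forall g k, phi g k \in unitmx),
      (forall g h, omega_lim0 w (fun k =>
          d_rk (phi (mul g h) k *m invmx (phi g k *m phi h k)) 1%:M)) &
      (forall g h, omega_lim0 w (fun k =>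
          d_rk (invmx (phi g k) *m phi h k) 1%:M) -> g = h)].

Definition linear_sofic (G : Type) (mul : G -> G -> G) : Prop :=
  exists w : (nat -> Prop) -> Prop,
    [/\ nat_ultrafilter w, non_principal w &
      exists n : nat -> nat, tends_to_infty n /\
        exists phi : G -> forall k : nat, 'M[complex]_(n k),
          @GL_ultraproduct_embedding G mul w (fun _ => complex : fieldType) n phi].

Definition bi_invariant_metric (H : finGroupType) (d : H -> H -> R) : Prop :=
  [/\ (forall x y, d x y = R0 <-> x = y),
      (forall x y, d x y = d y x),
      (forall x y z, Rle (d x z) (Rplus (d x y) (d y z))) &
      (forall x y g, d (g * x)%g (g * y)%g = d x y /\ d (x * g)%g (y * g)%g = d x y)].

(* G embeds in a metric ultraproduct prod_{k -> w} (H_k, d_k) of finite groups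
   with bi-invariant metrics (quotient of prod_k H_k by
   N = {(g_k) | lim_{k->w} d_k(g_k, e) = 0}); phi is a choice of lifts. *)
Definition weakly_sofic (G : Type) (mul : G -> G -> G) : Prop :=
  exists w : (nat -> Prop) -> Prop,
    [/\ nat_ultrafilter w, non_principal w &
      exists (H : nat -> finGroupType) (d : forall k, H k -> H k -> R),
        (forall k, bi_invariant_metric (d k)) /\
        exists phi : G -> forall k : nat, H k,
          (forall g h, omega_lim0 w (fun k =>
              d k (phi (mul g h) k * (phi g k * phi h k)^-1)%g 1%g)) /\
          (forall g h, omega_lim0 w (fun k =>
              d k ((phi g k)^-1 * phi h k)%g 1%g) -> g = h)].

(* Main.v *)
Require Import Defs.
From Stdlib Require Import Reals Classical ClassicalEpsilon.
From HB Require Import structures.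
From mathcomp Require Import all_boot all_order all_algebra all_fingroup
  all_field ring.

Set Implicit Arguments.
Unset Strict Implicit.

(** A finitely generated subring of a field has enough homomorphisms to finite
    fields (a Nullstellensatz over the integers): adjoining one element x at a
    time, one extends a homomorphism by sending x to a root, in a finite
    extension, of the reduction of a minimal polynomial of x, after inverting
    finitely many elements.  The rank of a matrix is certified by finitely many
    identities between finitely many scalars, hence it survives such a
    homomorphism.  So, for each k, the complex matrices attached to the first k
    elements of G and to their products can be replaced by matrices of the same
    size over a finite field with the same ranks of all relevant differences;
    the ultrafilter and the dimensions do not change, and neither do the
    limits along a non-principal ultrafilter. *)

Import GRing.Theory.

(** * Homomorphisms to finite fields: roots and the prime ring *)

Section Specialization.

Local Open Scope ring_scope.

(** A splitting field of [p] is a finite extension of [F], hence a finite field; the size bound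
    makes its list of roots nonempty. *)
Lemma finField_root (F : finFieldType) (p : {poly F}) : (1 < size p)%N ->
  exists (E : finFieldType) (j : {rmorphism F -> E}) (z : E),
    root (map_poly j p) z.
Proof.
move=> p_gt1; have p_neq0 : p != 0 by rewrite -size_poly_gt0 ltnW.
have [L [rs Dp _]] := FinSplittingFieldFor p_neq0.
exists (finvect_type L), (in_alg L : {rmorphism F -> finvect_type L}), rs`_0.
rewrite (eqp_root Dp) root_prod_XsubC mem_nth //.
by move: p_gt1; rewrite -(size_map_poly (in_alg L)) (eqp_size Dp) size_prod_XsubC.
Qed.

(* The kernel condition says that phi factors through the subring ev(T) of K,
   so this is a property of that subring alone. *)
Definition finField_separated (T : comNzRingType) (K : fieldType)
    (ev : {rmorphism T -> K}) : Prop :=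
  forall s, ev s != 0 -> exists (F : finFieldType) (phi : {rmorphism T -> F}),
    (forall t, ev t = 0 -> phi t = 0) /\ phi s != 0.

(** In characteristic p, reduce modulo p; in characteristic zero, a prime above [|s|] cannot divide
    the nonzero [s]. *)
Lemma finField_separated_int (K : fieldType) :
  finField_separated (intmul (1 : K) : {rmorphism int -> K}).
Proof.
move=> s s_neq0.
have [p [p_pr p_ker p_s]] : exists p, [/\ prime p,
    forall n, n%:R = 0 :> K -> (p %| n)%N & ~~ (p %| `|s|)%N].
  have [[p pK]|noch] := classic (exists p, p \in [pchar K]).
    exists p; split=> [|n|]; first exact: pcharf_prime pK.
      by move/eqP; rewrite (dvdn_pcharf pK).
    rewrite (dvdn_pcharf pK); apply: contra s_neq0 => /eqP s0; apply/eqP.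
    by case: s s0 => n s0; rewrite ?NegzE ?rmorphN /= ?[_%:~R]s0 ?oppr0.
  have [p p_gt p_pr] := prime_above `|s|.
  exists p; split=> // [[|n] n0 //|].
    by case: noch; apply: (natf0_pchar (n := n.+1)); rewrite ?n0.
  apply/negP => /dvdn_leq; rewrite lt0n absz_eq0 => le_ps.
  have s0 : s != 0 by apply: contraNneq s_neq0 => ->.
  by have := le_ps s0; rewrite leqNgt => /negP; apply.
have pF := pchar_Fp p_pr.
have kerE z : ((z%:~R : 'F_p) == 0) = (p %| `|z|)%N.
  by rewrite (dvdn_pcharf pF); case: z => n //; rewrite NegzE rmorphN oppr_eq0 abszN.
exists 'F_p, (intmul (1 : 'F_p)); split=> [t t0|]; last by rewrite kerE.
apply/eqP; rewrite kerE; apply: p_ker; move: t0.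
by case: t => n //; rewrite NegzE rmorphN abszN => /eqP; rewrite oppr_eq0 => /eqP.
Qed.

(** * Adjoining one element *)

Section Adjunction.

Variables (T : comNzRingType) (K : fieldType) (ev : {rmorphism T -> K}) (x : K).
Variable evx : {rmorphism {poly T} -> K}.

Local Notation evp := (map_poly ev).

Hypothesis evxE : forall p, evx p = (evp p).[x].

Lemma evxC t : evx t%:P = ev t.
Proof. by rewrite evxE map_polyC hornerC. Qed.

(** Truncation drops the top coefficients killed by [ev]. A nonzero lift then keeps its leading
    coefficient in [K], so pseudo-division by it only introduces scalars nonzero in [K]. *)
Lemma map_poly_lift_size p :
  exists2 p', evp p' = evp p & size p' = size (evp p).
Proof.
have E : evp (take_poly (size (evp p)) p) = evp p.
  apply/polyP=> i; rewrite coef_map coef_take_poly.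
  case: ltnP => [_|le_i]; rewrite ?coef_map //= raddf0.
  by rewrite -coef_map nth_default.
exists (take_poly (size (evp p)) p) => //.
by apply/eqP; rewrite eqn_leq size_take_poly -{1}E size_poly.
Qed.

Lemma size_map_poly_le p : (size (evp p) <= size p)%N.
Proof. exact: size_poly. Qed.

Lemma lead_coef_lift_neq0 (p : {poly T}) : p != 0 -> size p = size (evp p) ->
  ev (lead_coef p) != 0.
Proof.
move=> p0 szp; rewrite lead_coefE szp -coef_map -lead_coefE lead_coef_eq0.
by rewrite -size_poly_gt0 -szp size_poly_gt0.
Qed.

(** [psi] extends [phi] and sends ['X] to a root of the reduction of [r]. Its kernel clause covers
    only coefficientwise vanishing; vanishing at [x] is left to the two cases below. *)
Lemma specialize_root (F : finFieldType) (phi : {rmorphism T -> F}) r :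
    (forall t, ev t = 0 -> phi t = 0) -> (1 < size (map_poly phi r))%N ->
  exists (E : finFieldType) (psi : {rmorphism {poly T} -> E}),
    [/\ psi r = 0, forall t, phi t != 0 -> psi t%:P != 0
      & forall p, evp p = 0 -> psi p = 0].
Proof.
move=> phi_ker /finField_root[E [j [z rz]]].
exists E, (horner_eval z \o map_poly (j \o phi)); split=> /=.
- by rewrite map_poly_comp; apply/eqP: rz.
- by move=> t; rewrite horner_evalE map_polyC hornerC /= fmorph_eq0.
- move=> p p0; rewrite horner_evalE (_ : map_poly _ _ = 0) ?horner0 //.
  apply/polyP=> i; rewrite coef_map coef0 /= phi_ker ?rmorph0 //.
  by rewrite -coef_map p0 coef0.
Qed.

(** Here vanishing at [x] is coefficientwise vanishing, so the kernel condition is immediate; the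
    point is to find a value of ['X] at which [s] stays nonzero. *)
Lemma finField_separated_transcendental :
    (forall p, evx p = 0 -> evp p = 0) -> finField_separated ev ->
  finField_separated evx.
Proof.
move=> tr sepT s s0.
have s1 : evp s != 0.
  by apply: contraNneq s0 => E; rewrite evxE E horner0.
have [|F [phi [phi_ker phi_s]]] := sepT (s`_(size (evp s)).-1).
  by rewrite -coef_map -lead_coefE lead_coef_eq0.
have s2 : map_poly phi s != 0.
  by apply: contraNneq phi_s => E; rewrite -coef_map E coef0.
(* A root z of 'X * s + 1 satisfies s(z) != 0. *)
have [|E [psi [psi_r _ psi_ker]]] := @specialize_root F phi ('X * s + 1) phi_ker.
  rewrite rmorphD rmorphM /= map_polyX rmorph1 mulrC size_MXaddC.
  by rewrite (negPf s2) /= ltnS size_poly_gt0.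
exists E, psi; split=> [t /tr/psi_ker//|].
apply/eqP=> s3; move: psi_r; rewrite rmorphD rmorphM s3 mulr0 add0r rmorph1.
by move/eqP; rewrite oner_eq0.
Qed.

Section Algebraic.

(** [q] lifts a minimal polynomial of [x] without raising its degree. *)
Variable q : {poly T}.
Hypotheses (q_neq0 : q != 0) (q_size : size q = size (evp q)) (q_x : evx q = 0).
Hypothesis q_min :
  forall r, evx r = 0 -> (size (evp r) < size q)%N -> evp r = 0.

(* Euclid's algorithm by pseudo-division: minimality of q keeps the remainder
   of q by s from vanishing at x. *)
Lemma algebraic_bezout s : evx s != 0 ->
  exists (u v : {poly T}) (t : T), ev t != 0 /\ evp (u * s + v * q) = (ev t)%:P.
Proof.
have [n] := ubnP (size (evp s)); elim: n s => // n IHn s lt_s s_x.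
have [s' Es szs] := map_poly_lift_size s.
suff [u [v [t [t0 Et]]]] : exists u v t,
    ev t != 0 /\ evp (u * s' + v * q) = (ev t)%:P.
  by exists u, v, t; split=> //; rewrite -Et !rmorphD !rmorphM /= Es.
have {s_x} s_x : evx s' != 0 by rewrite evxE Es -evxE.
rewrite -szs in lt_s; rewrite -Es in szs; 
move: {s}s' szs lt_s s_x {Es} => s szs lt_s s_x.
have s0 : s != 0 by apply: contraNneq s_x => ->; rewrite rmorph0.
have [le_qs|lt_sq] := leqP (size q) (size s).
  have := Pdiv.ComRing.rdivp_eq q s.
  set c := _ ^+ _; set d := Pdiv.Ring.rdivp _ _; set r := Pdiv.Ring.rmodp _ _ => E.
  have c0 : ev c != 0 by rewrite rmorphXn expf_neq0 // lead_coef_lift_neq0.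
  have szr : (size r < size q)%N by apply: Pdiv.Ring.ltn_rmodpN0.
  have r_x : evx r != 0.
    have := congr1 evx E; rewrite -mul_polyC rmorphM rmorphD rmorphM q_x mulr0 add0r.
    move=> <-; rewrite mulf_neq0 // evxC //.
  have [|u [v [t [t0 Et]]]] := IHn r _ r_x.
    exact: leq_ltn_trans (size_map_poly_le _) (leq_trans szr (leq_trans le_qs lt_s)).
  exists (u * c%:P), (v - u * d), t; split=> //; rewrite -Et; congr evp.
  by rewrite -mulrA mul_polyC E; ring.
have [s_le1|s_gt1] := leqP (size s) 1.
  exists 1, 0, s`_0; rewrite mul1r mul0r addr0 [in evp s](size1_polyC s_le1).
  rewrite map_polyC; split=> //.
  by move: s_x; rewrite [s in evx s](size1_polyC s_le1) evxC.
have := Pdiv.ComRing.rdivp_eq s q.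
set c := _ ^+ _; set d := Pdiv.Ring.rdivp _ _; set r := Pdiv.Ring.rmodp _ _ => E.
have c0 : ev c != 0 by rewrite rmorphXn expf_neq0 // lead_coef_lift_neq0.
have szr : (size r < size s)%N by apply: Pdiv.Ring.ltn_rmodpN0.
have szr' := leq_ltn_trans (size_map_poly_le r) szr.
(* If [r] vanished at [x], minimality would kill it, then also [d], of smaller degree than [q]
   because [s] is not constant, and finally [q]. *)
have r_x : evx r != 0.
  apply/eqP=> r_x; have r0 := q_min r_x (ltn_trans szr' lt_sq).
  have := congr1 evx E; rewrite -mul_polyC rmorphM q_x mulr0 rmorphD rmorphM r_x addr0.
  move/esym/eqP; rewrite mulf_eq0 (negPf s_x) orbF => /eqP d_x.
  have := congr1 (fun p => size (evp p)) E.
  rewrite /= rmorphD rmorphM /= r0 addr0 -mul_polyC rmorphM /= map_polyC.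
  rewrite mul_polyC size_scale //.
  rewrite -q_size; have [d0|d0] := eqVneq (evp d) 0.
    by rewrite d0 mul0r size_poly0 => /eqP; rewrite size_poly_eq0 (negPf q_neq0).
  have s1 : evp s != 0 by rewrite -size_poly_gt0 -szs size_poly_gt0.
  rewrite size_mul // -szs => szq.
  have d1 : (size (evp d) < size q)%N.
    by rewrite szq; case: (size s) s_gt1 => [|[|m]] // _; rewrite !addnS ltnS leq_addr.
  by rewrite q_min ?eqxx in d0.
have [|u [v [t [t0 Et]]]] := IHn r _ r_x; first by rewrite (leq_trans szr').
exists (- (u * d)), (u * c%:P + v), t; split=> //; rewrite -Et; congr evp.
rewrite mulrDl -mulrA mul_polyC E; ring.
Qed.

(** Choose [phi] nonzero on the leading coefficient of [q] and on the Bezout scalar [t].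
    Pseudo-division by [q] then gives the kernel condition, and the Bezout identity forces [psi s]
    to be nonzero. *)
Lemma finField_separated_algebraic : finField_separated ev ->
  finField_separated evx.
Proof.
move=> sepT s /algebraic_bezout[u [v [t [t0 Et]]]].
set c := lead_coef q; have c0 : ev c != 0 by apply: lead_coef_lift_neq0.
have [|F [phi [phi_ker]]] := sepT (c * t); first by rewrite rmorphM mulf_neq0.
rewrite rmorphM mulf_eq0 negb_or => /andP[phi_c phi_t].
have [|E [psi [psi_q psi_c psi_ker]]] := @specialize_root F phi q phi_ker.
  (* The degree of [q] survives since [phi c] is nonzero; it is positive, as a constant [q]
     vanishing at [x] would have [ev c = 0]. *)
  rewrite size_poly_eq // ltnNge; apply: contra c0 => q_le1.
  move: q_x; rewrite [q in evx q](size1_polyC q_le1) evxC => E.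
  by rewrite /c (size1_polyC q_le1) lead_coefC E.
exists E, psi; split=> [p p_x|].
  have := Pdiv.ComRing.rdivp_eq q p.
  set a := _ ^+ _; set d := Pdiv.Ring.rdivp _ _; set r := Pdiv.Ring.rmodp _ _ => Ep.
  have szr : (size r < size q)%N by apply: Pdiv.Ring.ltn_rmodpN0.
  have r_x : evx r = 0.
    have := congr1 evx Ep; rewrite -mul_polyC rmorphM rmorphD rmorphM q_x p_x.
    by rewrite !mulr0 add0r.
  have r0 := q_min r_x (leq_ltn_trans (size_map_poly_le _) szr).
  have := congr1 psi Ep; rewrite -mul_polyC rmorphM rmorphD rmorphM psi_q mulr0 add0r.
  rewrite (psi_ker r) // => /eqP; rewrite mulf_eq0 => /orP[a0|/eqP//].
  by move: a0; rewrite (negPf (psi_c _ _)) // rmorphXn expf_neq0.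
have ker_t : evp (u * s + v * q - t%:P) = 0.
  by rewrite raddfB /= Et map_polyC subrr.
apply/eqP=> psi_s; have := psi_ker _ ker_t.
rewrite rmorphB rmorphD !rmorphM psi_s psi_q !mulr0 !add0r => /eqP.
by rewrite oppr_eq0; apply/negP/psi_c.
Qed.

End Algebraic.

Lemma finField_separated_poly : finField_separated ev ->
  finField_separated evx.
Proof.
have [tr|alg] := classic (forall p, evx p = 0 -> evp p = 0).
  exact: finField_separated_transcendental.
have [n [[q [q_x q0 szq]] n_min]] : exists n,
    (exists q, [/\ evx q = 0, evp q != 0 & size (evp q) = n]) /\
    (forall r, evx r = 0 -> (size (evp r) < n)%N -> evp r = 0).
  (* Without a least degree, strong induction on the size makes every relation of [x] trivial. *)
  apply: NNPP => none; apply: alg => p p_x.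
  have [n] := ubnP (size (evp p)); elim: n p p_x => // n IHn p p_x lt_p.
  apply: NNPP => /eqP p0; apply: none; exists (size (evp p)).
  split; first by exists p.
  by move=> r r_x lt_r; apply: IHn r_x _; apply: leq_trans lt_r _.
have [q' Eq sz_q'] := map_poly_lift_size q.
apply: (@finField_separated_algebraic q'); rewrite ?sz_q' ?szq ?Eq //.
  by rewrite -size_poly_gt0 sz_q' size_poly_gt0.
by rewrite evxE Eq -evxE.
Qed.

End Adjunction.

(** [T] is an iterated polynomial ring over [int], with one indeterminate for each element of
    [xs]. *)
Lemma finField_separated_adjoin (K : fieldType) (xs : seq K) :
  exists (T : comNzRingType) (ev : {rmorphism T -> K}),
    finField_separated ev /\ {in xs, forall x, exists t, ev t = x}.
Proof.
elim: xs => [|x xs [T [ev [sepT evT]]]].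
  exists int, (intmul (1 : K)); split=> //; exact: finField_separated_int.
exists {poly T}, (horner_eval x \o map_poly ev); split.
  by apply: (@finField_separated_poly _ _ ev x).
move=> y; rewrite inE => /predU1P[->|/evT[t <-]].
  by exists 'X; rewrite /= map_polyX horner_evalE hornerX.
by exists t%:P; rewrite /= map_polyC horner_evalE hornerC.
Qed.

(** * Specialising matrices and their ranks *)

Definition mx_entries (K : eqType) m n (A : 'M[K]_(m, n)) : seq K :=
  [seq A i j | i <- enum 'I_m, j <- enum 'I_n].

Lemma mem_mx_entries (K : eqType) m n (A : 'M[K]_(m, n)) i j :
  A i j \in mx_entries A.
Proof. by apply: allpairs_f; rewrite mem_enum. Qed.

Lemma lift_mx (T K : Type) (ev : T -> K) m n (A : 'M[K]_(m, n)) :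
  (forall i j, exists t, ev t = A i j) -> exists A', map_mx ev A' = A.
Proof.
move=> evA; pose f i j := constructive_indefinite_description _ (evA i j).
exists (\matrix_(i, j) proj1_sig (f i j)); apply/matrixP=> i j.
by rewrite !mxE; case: (f i j).
Qed.

Lemma map_mx_eq_spec (T : comNzRingType) (K F : fieldType)
    (ev : {rmorphism T -> K}) (phi : {rmorphism T -> F}) m n
    (A B : 'M[T]_(m, n)) :
    (forall t, ev t = 0 -> phi t = 0) ->
  map_mx ev A = map_mx ev B -> map_mx phi A = map_mx phi B.
Proof.
move=> phi_ker /matrixP eqAB; apply/matrixP=> i j; have := eqAB i j.
rewrite !mxE => /eqP; rewrite -subr_eq0 -rmorphB => /eqP/phi_ker/eqP.
by rewrite rmorphB subr_eq0 => /eqP.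
Qed.

(* The rank r of A is witnessed by a factorisation of A through dimension r
   and an identity M A N = 1 of size r; both survive specialisation. *)
Lemma rank_specialization (T : comNzRingType) (K F : fieldType)
    (ev : {rmorphism T -> K}) (phi : {rmorphism T -> F}) m n
    (A' : 'M[T]_(m, n)) (A := map_mx ev A') :
    (forall t, ev t = 0 -> phi t = 0) ->
    (exists C, map_mx ev C = col_base A) ->
    (exists R, map_mx ev R = row_base A) ->
    (exists M, map_mx ev M = pinvmx (col_base A)) ->
    (exists N, map_mx ev N = pinvmx (row_base A)) ->
  \rank (map_mx phi A') = \rank A.
Proof.
move=> phi_ker [C eC] [R eR] [M eM] [N eN]; apply/eqP; rewrite eqn_leq.
have -> : map_mx phi A' = map_mx phi C *m map_mx phi R.
  rewrite -map_mxM; apply: map_mx_eq_spec phi_ker _.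
  by rewrite map_mxM eC eR mulmx_base.
rewrite mulmx_max_rank.
apply: (@mulmx1_min_rank _ _ _ _ _ (map_mx phi M) (map_mx phi N)).
rewrite -!map_mxM -(map_mx1 phi); apply: map_mx_eq_spec phi_ker _.
rewrite !map_mxM map_mx1 eC eR eM eN mulmxA mulVpmx ?col_base_full // mul1mx.
by rewrite mulmxVp ?row_base_free.
Qed.

Lemma finField_rank_specialization (K : fieldType) n (Ms : seq 'M[K]_n) :
  exists (F : finFieldType) (psi : 'M[K]_n -> 'M[F]_n),
    [/\ {in Ms, forall A, \rank (psi A) = \rank A},
        {in Ms &, forall A B, A - B \in Ms -> psi (A - B) = psi A - psi B}
      & {in Ms &, forall A B, A *m B \in Ms -> psi (A *m B) = psi A *m psi B}].
Proof.
pose data (A : 'M[K]_n) := mx_entries A ++ mx_entries (col_base A) ++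
  mx_entries (row_base A) ++ mx_entries (pinvmx (col_base A)) ++
  mx_entries (pinvmx (row_base A)).
pose xs := flatten [seq data A | A <- Ms].
have [T [ev [sepT evT]]] := finField_separated_adjoin xs.
(* No particular scalar has to stay nonzero: the ranks are certified by identities, which the kernel
   condition preserves. *)
have [|F [phi [phi_ker _]]] := sepT 1; first by rewrite rmorph1 oner_neq0.
have lift_xs m p (B : 'M[K]_(m, p)) :
    {subset mx_entries B <= xs} -> exists B', map_mx ev B' = B.
  by move=> sBxs; apply: lift_mx => i j; apply/evT/sBxs/mem_mx_entries.
have sub_xs A : A \in Ms -> {subset data A <= xs}.
  by move=> MsA x Ax; apply/flatten_mapP; exists A.
pose lift (A : 'M[K]_n) := epsilon (inhabits 0) (fun A' : 'M[T]_n => map_mx ev A' = A).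
have liftK A : A \in Ms -> map_mx ev (lift A) = A.
  move=> MsA; apply: (epsilon_spec (inhabits 0) (fun A' : 'M[T]_n => map_mx ev A' = A)).
  by apply: lift_xs => x Ax; apply: (sub_xs A MsA); rewrite !mem_cat Ax.
exists F, (fun A => map_mx phi (lift A)); split=> [A MsA|A B MsA MsB MsD|A B MsA MsB MsD].
- rewrite -[in RHS](liftK A MsA); apply: rank_specialization => //;
  rewrite liftK //; apply: lift_xs => x Ax; apply: (sub_xs A MsA);
  by rewrite !mem_cat Ax ?orbT.
- rewrite -map_mxB; apply: map_mx_eq_spec phi_ker _.
  by rewrite map_mxB !liftK.
rewrite -map_mxM; apply: map_mx_eq_spec phi_ker _.
by rewrite map_mxM !liftK.
Qed.

End Specialization.

(** * Transferring finitely many ultraproduct conditions *)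

Section Transfer.

Local Open Scope ring_scope.

(** Factoring out a unit removes the inverse, so only products and differences need to be
    specialised. *)
Lemma rank_mulVmx_sub1 (F : fieldType) n (A B : 'M[F]_n) : A \in unitmx ->
  \rank (invmx A *m B - 1%:M) = \rank (B - A).
Proof.
move=> uA; rewrite -(mulVmx uA) -mulmxBr; apply: eqmx_rank.
by apply/eqmxP/eqmxMfull; rewrite row_full_unit unitmx_inv.
Qed.

Lemma rank_mulmxV_sub1 (F : fieldType) n (A B : 'M[F]_n) : B \in unitmx ->
  \rank (A *m invmx B - 1%:M) = \rank (A - B).
Proof.
by move=> uB; rewrite -(mulmxV uB) -mulmxBl mxrankMfree // row_free_unit unitmx_inv.
Qed.

Lemma finField_transfer (K : fieldType) n (I : eqType) (J : seq I)
    (op : I -> I -> I) (A : I -> 'M[K]_n) :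
    (forall i, A i \in unitmx) ->
  exists (F : finFieldType) (B : I -> 'M[F]_n),
    [/\ forall i, B i \in unitmx,
        {in J &, forall i j, \rank (B (op i j) *m invmx (B i *m B j) - 1%:M)
                           = \rank (A (op i j) *m invmx (A i *m A j) - 1%:M)}
      & {in J &, forall i j, \rank (invmx (B i) *m B j - 1%:M)
                           = \rank (invmx (A i) *m A j - 1%:M)}].
Proof.
(* [op i j] may lie outside [J], so its matrix is listed separately. *)
move=> uA; pose Ms := [seq A i | i <- J] ++
  [seq A (op i j) | i <- J, j <- J] ++ [seq A i *m A j | i <- J, j <- J] ++
  [seq A (op i j) - A i *m A j | i <- J, j <- J] ++
  [seq A j - A i | i <- J, j <- J].
have [F [psi [psi_rank psiB psiM]]] := finField_rank_specialization Ms.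
have Ms1 i : i \in J -> A i \in Ms by move=> Ji; rewrite mem_cat map_f.
have Ms2 i j : i \in J -> j \in J -> [/\ A (op i j) \in Ms,
    A i *m A j \in Ms, A (op i j) - A i *m A j \in Ms & A j - A i \in Ms].
  move=> Ji Jj; split; rewrite !mem_cat.
  - by rewrite (allpairs_f (fun i j => A (op i j)) Ji Jj) !orbT.
  - by rewrite (allpairs_f (fun i j => A i *m A j) Ji Jj) !orbT.
  - by rewrite (allpairs_f (fun i j => A (op i j) - A i *m A j) Ji Jj) !orbT.
  - by rewrite (allpairs_f (fun i j => A j - A i) Ji Jj) !orbT.
have psi_unit i : A i \in Ms -> psi (A i) \in unitmx.
  by move=> /psi_rank rkA; rewrite -row_free_unit /row_free rkA mxrank_unit.
(* Outside [Ms] the value of [psi] may be singular; the identity replaces it there. *)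
exists F, (fun i => if psi (A i) \in unitmx then psi (A i) else 1%:M).
split=> [i|i j Ji Jj|i j Ji Jj]; first by case: ifP; rewrite ?unitmx1.
  have [M1 M2 M3 M4] := Ms2 i j Ji Jj.
  rewrite !psi_unit ?M1 ?Ms1 // !rank_mulmxV_sub1 ?unitmx_mul ?uA ?psi_unit ?Ms1 //.
  by rewrite -psiM ?Ms1 // -psiB // psi_rank.
have [_ _ _ M4] := Ms2 i j Ji Jj.
rewrite !psi_unit ?Ms1 // !rank_mulVmx_sub1 ?uA ?psi_unit ?Ms1 //.
by rewrite -psiB ?Ms1 // psi_rank.
Qed.

End Transfer.

(** * Limits along a non-principal ultrafilter *)

Section Ultrafilter.

Variable w : (nat -> Prop) -> Prop.
Hypotheses (uw : nat_ultrafilter w) (npw : non_principal w).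

Lemma non_principal_ge m : w (fun k => (m <= k)%N).
Proof.
case: uw => wT w0 wS wI wC; elim: m => [|m IHm]; first exact: wS wT _.
case: (wC (fun k => k = m)) => [/npw//|wm].
apply: wS (wI _ _ IHm wm) _ => k [le_mk /eqP ne_km].
by rewrite ltn_neqAle eq_sym ne_km.
Qed.

Lemma omega_lim0_eventually_eq (x y : nat -> R) m :
  (forall k, (m <= k)%N -> x k = y k) -> omega_lim0 w x -> omega_lim0 w y.
Proof.
case: (uw) => wT w0 wS wI wC eq_xy limx eps eps_gt0.
apply: wS (wI _ _ (non_principal_ge m) (limx eps eps_gt0)) _.
by move=> k [/eq_xy<-].
Qed.

End Ultrafilter.

(* Unlike MathComp's {'GL_n[F]}, this also covers n = 0 without a cast. *)
Definition GL_sub (F : finFieldType) (n : nat) := {A : 'M[F]_n | A \in unitmx}.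

(** * The finite group GL with its rank metric *)

Section GLSub.

Local Open Scope ring_scope.

Variables (F : finFieldType) (n : nat).

HB.instance Definition _ := SubFinite.on (GL_sub F n).

Implicit Types x y z : GL_sub F n.

Definition GL_sub_one : GL_sub F n := Sub 1%:M (unitmx1 F n).

Lemma GL_sub_mul_subproof x y : val x *m val y \in unitmx.
Proof. by rewrite unitmx_mul (valP x) (valP y). Qed.

Definition GL_sub_mul x y : GL_sub F n := Sub (val x *m val y) (GL_sub_mul_subproof x y).

Lemma GL_sub_inv_subproof x : invmx (val x) \in unitmx.
Proof. by rewrite unitmx_inv (valP x). Qed.

Definition GL_sub_inv x : GL_sub F n := Sub (invmx (val x)) (GL_sub_inv_subproof x).

Lemma GL_sub_mulA : associative GL_sub_mul.
Proof. by move=> x y z; apply/val_inj/mulmxA. Qed.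

Lemma GL_sub_mul1 : left_id GL_sub_one GL_sub_mul.
Proof. by move=> x; apply/val_inj/mul1mx. Qed.

Lemma GL_sub_mulV : left_inverse GL_sub_one GL_sub_inv GL_sub_mul.
Proof. by move=> x; apply/val_inj/mulVmx/(valP x). Qed.

HB.instance Definition _ :=
  Finite_isGroup.Build (GL_sub F n) GL_sub_mulA GL_sub_mul1 GL_sub_mulV.

Definition GL_sub_dist x y : R := d_rk (val x) (val y).

Lemma GL_sub_dist_bi_invariant : bi_invariant_metric GL_sub_dist.
Proof.
have divn r s : (r <= s)%N -> Rle (INR r / INR n) (INR s / INR n).
  move=> le_rs; apply: Rmult_le_compat_r; last exact/le_INR/leP.
  (* For [n = 0], division by zero gives the value 0. *)
  case: (n) => [|m]; first by rewrite /= Rinv_0; apply: Rle_refl.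
  by apply/Rlt_le/Rinv_0_lt_compat/lt_0_INR/ltP.
split=> [x y|x y|x y z|x y g].
- split=> [|->]; last by rewrite /GL_sub_dist /d_rk subrr mxrank0 /Rdiv Rmult_0_l.
  rewrite /GL_sub_dist /d_rk => /Rmult_integral[/(INR_eq _ 0)/eqP|n0].
    by rewrite mxrank_eq0 subr_eq0 => /eqP/val_inj.
  (* A zero inverse forces dimension 0, where all matrices coincide. *)
  have n_eq0 : n = 0%N.
    apply: NNPP => n_neq0; move: n0; apply: Rinv_neq_0_compat.
    exact: not_0_INR.
  apply/val_inj/matrixP=> i; have := ltn_ord i.
  by rewrite [X in (_ < X)%N]n_eq0.
- by rewrite /GL_sub_dist /d_rk -opprB mxrank_opp.
- rewrite /GL_sub_dist /d_rk -Rdiv_plus_distr -plus_INR; apply: divn.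
  by rewrite -[X in \rank X](subrKA (val y)) mxrank_add.
rewrite /GL_sub_dist /d_rk; split; congr Rdiv; congr INR.
  rewrite /= -mulmxBr; apply/eqmx_rank/eqmxP/eqmxMfull.
  by rewrite row_full_unit (valP g).
by rewrite /= -mulmxBl mxrankMfree // row_free_unit (valP g).
Qed.

End GLSub.

(** * Weak soficity and the final embedding *)

Lemma weakly_sofic_of_GL_ultraproduct (G : Type) (mul : G -> G -> G)
    (w : (nat -> Prop) -> Prop) (n : nat -> nat) (F : nat -> finFieldType)
    (Phi : G -> forall k, 'M[F k]_(n k)) :
  nat_ultrafilter w -> non_principal w ->
  @GL_ultraproduct_embedding G mul w (fun k => F k : fieldType) n Phi ->
  weakly_sofic mul.
Proof.
move=> uw npw [Phi_unit Phi_mul Phi_inj]; exists w; split=> //.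
exists (fun k => GL_sub (F k) (n k)), (fun k => @GL_sub_dist (F k) (n k)).
split=> [k|]; first exact: GL_sub_dist_bi_invariant.
(* The group law of [GL_sub] computes to matrix operations, so both conditions are those on [Phi] up
   to conversion. *)
by exists (fun g k => Sub (Phi g k) (Phi_unit g k)); split.
Qed.

Theorem mainTheorem3 (G : Type) (mul : G -> G -> G) (inv : G -> G) (one : G) :
  @group_axioms G mul inv one ->
  countable_type G ->
  @linear_sofic G mul ->
  (exists w : (nat -> Prop) -> Prop,
     [/\ nat_ultrafilter w, non_principal w &
       exists n : nat -> nat, tends_to_infty n /\
         exists (F : nat -> finFieldType)
                (Phi : G -> forall k : nat, 'M[F k]_(n k)),
           @GL_ultraproduct_embedding G mul w (fun k => F k : fieldType) n Phi])
  /\ @weakly_sofic G mul.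
Proof.
move=> _ [f f_inj] [w [uw npw [n [n_infty [phi [phi_unit phi_mul phi_inj]]]]]].
suff [F [Phi emb]] : exists (F : nat -> finFieldType)
    (Phi : G -> forall k, 'M[F k]_(n k)),
    @GL_ultraproduct_embedding G mul w (fun k => F k : fieldType) n Phi.
  split; last exact: weakly_sofic_of_GL_ultraproduct uw npw emb.
  by exists w; split=> //; exists n; split=> //; exists F, Phi.
pose I : eqType := inj_type f_inj.
(* [e] inverts [f] on its range and is arbitrary elsewhere; thus [J k] contains every element of
   code below [k]. *)
pose e i : I := epsilon (inhabits one) (fun g => f g = i).
pose J k := [seq e i | i <- iota 0 k].
have memJ k g : (f g < k)%N -> (g : I) \in J k.
  move=> lt_gk; have <- : e (f g) = g.
    by apply/f_inj/(epsilon_spec (inhabits one) (fun h => f h = f g)); exists g.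
  by rewrite map_f // mem_iota.
pose FB k := constructive_indefinite_description _
  (@finField_transfer complex (n k) I (J k) mul (phi^~ k) (phi_unit^~ k)).
pose F k := proj1_sig (FB k).
pose B k := constructive_indefinite_description _ (proj2_sig (FB k)).
have [B_unit B_mul B_inv] := all_and3 (fun k => proj2_sig (B k)).
have close g h k : (maxn (f g) (f h) < k)%N -> (g : I) \in J k /\ (h : I) \in J k.
  by rewrite gtn_max => /andP[? ?]; split; apply: memJ.
exists F, (fun g k => proj1_sig (B k) g); split=> [g k|g h|g h lim_gh].
- exact: B_unit.
(* Beyond both codes, [g] and [h] lie in [J k] and the ranks agree exactly. *)
- apply: (omega_lim0_eventually_eq uw npw (m := (maxn (f g) (f h)).+1)
    _ (phi_mul g h)) => k /close[Jg Jh].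
  by rewrite /d_rk (B_mul k g h Jg Jh).
apply: phi_inj.
apply: (omega_lim0_eventually_eq uw npw (m := (maxn (f g) (f h)).+1)
  _ lim_gh) => k /close[Jg Jh].
by rewrite /d_rk (B_inv k g h Jg Jh).
Qed.
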